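(* Any finitely generated group with exponential growth and linear divergence admits exponentially many fat bigons.
   Context: All graphs are connected, have uniformly bounded degree, and are metric spaces with the shortest path metric (edges of length 1). A finitely generated group is regarded as its Cayley graph with respect to some finite symmetric generating set, and properties of the group refer to this graph. For $r\ge 0$, $B_r(x)$ is the closed ball of radius $r$ about $x$, and $N_r(Y)=\{x : d(x,Y)\le r\}$. Divergence: let $X$ be a Cayley graph of a finitely generated group. The divergence of a pair of points $a,b\in X$ relative to a point $c\notin\{a,b\}$ is the length of the shortest path from $a$ to $b$ avoiding the ball around $c$ of radius $\frac12 d(c,\{a,b\})-2$ (a ball of negative radius is empty; the value is $\infty$ if there is no such path; such paths always exist if the group is one-ended). $Div(a,b)$ is the supremum of the divergences of $a,b$ relative to all $c\in X\setminus\{a,b\}$, and $Div_X(n)=\max\{Div(a,b) : d(a,b)\le n\}$. The group has linear divergence if there is a constant $C$ with $Div_X(n)\le Cn$ for all integers $n\ge 1$. Fat bigons: let $X$ be a graph with base vertex $x_0$, and let $x$ be a vertex. Given $L\ge 1$ and $s,C\ge 0$, an $(L,s,C)$-bigon at $x$ is a pair of paths $\alpha_1,\alpha_2$ in $X$ from $x_0$ to $x$ such that (1) $l(\alpha_i)\le L\,d(x_0,x)$ for $i=1,2$, where $l$ is length; (2) with $B=N_C(\{x_0,x\})$, we have $d(\alpha_1\setminus B,\alpha_2\setminus B)>s$ (this holds by convention if one of the two sets is empty). Let $\mathcal B^X(L,s,C)$ be the set of vertices $x$ such that there exists an $(L,s,C)$-bigon at $x$. $X$ has (or admits) exponentially many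 fat bigons at $x_0$ if there exist constants $s_0,c,L>1$ such that for every $s\ge s_0$ there exists $C$ such that $|\mathcal B^X(L,s,C)\cap B_n(x_0)|\ge c^n$ for infinitely many $n\in\mathbb N$. This property does not depend on the choice of $x_0$. *)

(* Defs.v *)
From mathcomp Require Import all_boot all_order all_algebra.
From mathcomp Require Import finmap.
From mathcomp Require Import all_classical all_reals all_analysis.

Set Implicit Arguments.
Unset Strict Implicit.
Unset Printing Implicit Defensive.

Import Order.TTheory GRing.Theory Num.Theory.
Local Open Scope classical_set_scope.
Local Open Scope ring_scope.

(* A graph is an adjacency relation [e] on a vertex type [V], regarded as the
   metric space of its vertices.  A path from [x] to [y] is given by the list
   [p] of the vertices that follow [x], so that it has length [size p] and its
   vertices are those of [x :: p]. *)

Section Graph.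
Context {V : choiceType} (e : rel V).

Definition is_path (x y : V) (p : seq V) : Prop := path e x p /\ last x p = y.

Definition has_path_of_length (x y : V) : pred nat :=
  fun n => `[< exists p, is_path x y p /\ size p = n >].

(* The value is 0 if no path joins [x] to [y]; the notion is only meant for
   connected graphs. *)
Definition gdist (x y : V) : nat :=
  if pselect (exists n, has_path_of_length x y n) is left h
  then ex_minn h else 0%N.

Context {R : realType}.

Definition gball (x : V) (r : R) : set V := [set y | (gdist x y)%:R <= r].

(* Distances to and between sets are infima in the extended reals, so that they
   are [+oo] if one of the sets is empty. *)
Definition dist_sets (A B : set V) : \bar R :=
  ereal_inf [set d | exists x y, [/\ A x, B y & d = (gdist x y)%:R%:E]].

Definition set_nbhd (r : R) (Y : set V) : set V :=
  [set x | (dist_sets [set x] Y <= r%:E)%E].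

(* [fset_set A] is empty when [A] is infinite; balls of a locally finite graph,
   such as a Cayley graph, are finite. *)
Definition exponential_growth (x0 : V) : Prop :=
  exists2 c : R, 1 < c &
    forall n : nat, c ^+ n <= #|` fset_set (gball x0 n%:R) |%fset%:R.

(* As [c] is a vertex, an edge whose two ends lie outside a ball around [c] lies
   entirely outside it. *)
Definition divergence (a b c : V) : \bar R :=
  let r := (minn (gdist c a) (gdist c b))%:R / 2 - 2 in
  ereal_inf [set l | exists p, [/\ is_path a b p,
                                   {in a :: p, forall v, ~ gball c r v} &
                                   l = (size p)%:R%:E]].

Definition Div (a b : V) : \bar R :=
  ereal_sup [set divergence a b c | c in [set c | c != a /\ c != b]].

Definition Div_graph (n : nat) : \bar R :=
  ereal_sup [set d | exists a b, (gdist a b <= n)%N /\ d = Div a b].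

Definition linear_divergence : Prop :=
  exists C : R, forall n : nat, (1 <= n)%N -> (Div_graph n <= (C * n%:R)%:E)%E.

Definition is_bigon (x0 : V) (L s C : R) (x : V) (p1 p2 : seq V) : Prop :=
  let B := set_nbhd C [set x0; x] in
  [/\ is_path x0 x p1, is_path x0 x p2,
      (size p1)%:R <= L * (gdist x0 x)%:R,
      (size p2)%:R <= L * (gdist x0 x)%:R &
      (s%:E < dist_sets ([set` x0 :: p1] `\` B) ([set` x0 :: p2] `\` B))%E].

Definition bigon_vertices (x0 : V) (L s C : R) : set V :=
  [set x | exists p1 p2, is_bigon x0 L s C x p1 p2].

Definition exponentially_many_fat_bigons (x0 : V) : Prop :=
  exists s0 c L : R, [/\ 1 < s0, 1 < c, 1 < L &
    forall s, s0 <= s -> exists2 C : R, 0 <= C &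
      infinite_set [set n : nat |
        c ^+ n <=
          #|` fset_set (bigon_vertices x0 L s C `&` gball x0 n%:R) |%fset%:R]].

End Graph.

Arguments exponential_growth {V} e R x0.
Arguments linear_divergence {V} e R.
Arguments exponentially_many_fat_bigons {V} e R x0.

Definition symmetric_generating_set (G : groupType) (S : {fset G}) : Prop :=
  {in S, forall s, s^-1%g \in S} /\
  forall g : G, exists2 w : seq G,
    {subset w <= S} & g = (\prod_(s <- w) s)%g.

Definition cayley (G : groupType) (S : {fset G}) : rel G :=
  fun x y => (x^-1 * y)%g \in S.

(* Main.v *)
Require Import Defs.
From mathcomp Require Import all_boot all_order all_algebra.
From mathcomp Require Import finmap.
From mathcomp Require Import all_classical all_reals all_analysis.
From mathcomp Require Import zify ring lra.

(** A fat bigon comes for free on the middle third of a geodesic.  Let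
    [a, x0, x, b] lie in this order on a geodesic of length [3 n], at distance
    [n] from one to the next, and let [c] be a midpoint of [x0] and [x].  Then
    [c] is at distance about [3 n / 2] from [a] and [b], so linear divergence
    provides a path from [a] to [b], of length linear in [n], that avoids the
    ball of radius about [3 n / 4] around [c].  That ball contains the
    [s]-neighbourhood of a geodesic from [x0] to [x] through [c], which only
    reaches [n / 2] away from [c].  The bigon at [x] consists of this geodesic
    and of the path that runs back from [x0] to [a], takes the detour to [b] and
    returns to [x]: on its two outer parts, a point at distance [t] from [x0]
    (resp. [x]) is at distance at least [t] from the geodesic, so that these
    parts are far away outside of balls of radius [s + 1] around the endpoints
    ([bigon_in_long_geodesic]).

    It remains to see that, for infinitely many [n], exponentially many group
    elements [x] of length [n] occur as the middle third of some geodesic word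
    [a x b] of length [3 n].  Let [a_n] be the size of the sphere of radius [n]
    and [M_n] the number of middle thirds, so that [a_(3n) <= a_n ^ 2 M_n].
    As [a] is submultiplicative with exponentially growing partial sums, it
    satisfies [a_n >= t ^ n] for some [t > 1]
    ([submultiplicative_lower_bound]).  If [M_n] were smaller than
    [sqrt t ^ n] for all large [n], then iterating the inequality along
    [n = 3 ^ k N] would push the exponential growth rate of [a] along that
    sequence down to [sqrt t], a contradiction ([middle_lower_bound]).  By
    homogeneity the count at the identity is a count at any base point. *)

Set Implicit Arguments.
Unset Strict Implicit.
Unset Printing Implicit Defensive.

Import Order.TTheory GRing.Theory Num.Theory.
Local Open Scope classical_set_scope.
Local Open Scope ring_scope.

(** * Growth of submultiplicative sequences *)

Lemma bernoulli_ineq (R : realType) (t : R) n :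
  1 <= t -> 1 + n%:R * (t - 1) <= t ^+ n.
Proof.
move=> t1; elim: n => [|n IH]; first by rewrite mul0r addr0 expr0.
apply: (@le_trans _ _ ((1 + n%:R * (t - 1)) * t)); last first.
  by rewrite exprSr ler_wpM2r // (le_trans ler01).
rewrite -natr1; have : 0 <= n%:R * ((t - 1) * (t - 1)) :> R.
  by rewrite mulr_ge0 // mulr_ge0 // subr_ge0.
nra.
Qed.

Lemma expr_unbounded (R : realType) (t K : R) : 1 < t -> exists n, K < t ^+ n.
Proof.
move=> t1; pose n := Num.bound `|K / (t - 1)|.
have tp : 0 < t - 1 by rewrite subr_gt0.
exists n; apply: lt_le_trans (bernoulli_ineq n (ltW t1)).
have : K / (t - 1) < n%:R.
  by apply: le_lt_trans (ler_norm _) (archi_boundP (normr_ge0 _)).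
by rewrite ltr_pdivrMr // => h; apply: lt_trans h _; rewrite ltrDr.
Qed.

(** In [middle_lower_bound] the radii grow like [3 ^ k] and the errors like
    [2 ^ k]; this is where the radii win. *)
Lemma pow3_gt j : (j * 2 ^ (2 * j) < 3 ^ (2 * j))%N.
Proof.
have H k : (2 ^ k * (k + 2) <= 2 * 3 ^ k)%N.
  by elim: k => // k IH; rewrite !expnS; nia.
have := H (2 * j)%N; have : (0 < 2 ^ (2 * j))%N by rewrite expn_gt0.
nia.
Qed.

(** If [a m < t ^ m] for a single [m > 0], then submultiplicativity spreads this
    bound, up to a constant factor, to all indices, and the partial sums of [a]
    are [O(n t ^ n)].  This is too small once [t] is a proper root of [c]; the
    fourth root leaves ample room. *)
Lemma submultiplicative_lower_bound (R : realType) (a : nat -> nat) (c : R) :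
  1 < c -> (forall m n, (a (m + n) <= a m * a n)%N) ->
  (forall n, c ^+ n <= (\sum_(i < n.+1) a i)%N%:R) ->
  exists2 t : R, 1 < t & forall m, (0 < m)%N -> t ^+ m <= (a m)%:R.
Proof.
move=> c1 aM growth; have c0 : 0 <= c by apply: ltW; apply: lt_trans c1.
pose t := Num.sqrt (Num.sqrt c).
have t1 : 1 < t by rewrite /t -[1]sqrtr1 ltr_sqrt ?sqrtr_gt0 ?(lt_trans _ c1) //
  -[1]sqrtr1 ltr_sqrt // (lt_trans _ c1).
have t0 : 0 < t by apply: lt_trans t1.
have ct : c = t ^+ 4 by rewrite /t (exprM _ 2 2) !sqr_sqrtr ?sqrtr_ge0.
exists t => // m m0; rewrite leNgt; apply/negP => am.
pose A := (\sum_(r < m) a r)%N.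
have bound n : (a n)%:R <= A%:R * t ^+ n :> R.
  elim/ltn_ind: n => n IH; have [nm|mn] := ltnP n m.
    apply: (@le_trans _ _ A%:R).
      by rewrite ler_nat /A (bigD1 (Ordinal nm)) //= leq_addr.
    by rewrite ler_peMr // exprn_ege1 // ltW.
  rewrite -(subnKC mn) exprD mulrCA.
  apply: le_trans (_ : (a m)%:R * (a (n - m)%N)%:R <= _).
    by rewrite -natrM ler_nat aM.
  by apply: ler_pM => //; [exact: ltW|apply: IH; lia].
have sum_bound n : (\sum_(i < n.+1) a i)%N%:R <= A%:R * (n.+1)%:R * t ^+ n :> R.
  rewrite natr_sum; apply: le_trans (_ : \sum_(i < n.+1) A%:R * t ^+ n <= _).
    apply: ler_sum => i _; apply: le_trans (bound i) _.
    by rewrite ler_wpM2l // ler_weXn2l ?ltW // -ltnS.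
  by rewrite sumr_const card_ord -[_ *+ n.+1]mulr_natr mulrAC.
(* Bernoulli's inequality lets [K t ^ n] absorb the number of summands. *)
pose K := 1 + (t - 1)^-1; have K0 : 0 <= K by rewrite addr_ge0 // invr_ge0; lra.
have linear n : n.+1%:R <= K * t ^+ n.
  apply: le_trans (_ : K * (1 + n%:R * (t - 1)) <= _).
    rewrite /K -natr1 -subr_ge0.
    have -> : (1 + (t - 1)^-1) * (1 + n%:R * (t - 1)) - (n%:R + 1) =
        (t - 1)^-1 + n%:R * (t - 1) by field; lra.
    by rewrite addr_ge0 ?mulr_ge0 ?invr_ge0 //; lra.
  by rewrite ler_wpM2l // bernoulli_ineq // ltW.
have [n] := expr_unbounded (A%:R * K) t1; apply/negP; rewrite -leNgt.
have tn0 : 0 < t ^+ n by exact: exprn_gt0.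
have : t ^+ n * (t ^+ n * (t ^+ n * t ^+ n)) <= A%:R * (K * t ^+ n) * t ^+ n.
  rewrite -!exprD; apply: le_trans (_ : A%:R * n.+1%:R * t ^+ n <= _).
    apply: le_trans (sum_bound n); apply: le_trans (growth n).
    by rewrite ct -exprM; have -> : (4 * n = n + (n + (n + n)))%N by lia.
  by rewrite ler_wpM2r ?(ltW tn0) // ler_wpM2l.
have -> : A%:R * (K * t ^+ n) * t ^+ n = t ^+ n * (t ^+ n * (A%:R * K)) by ring.
rewrite !ler_pM2l //; apply: le_trans.
by apply: ler_peMr; [exact: ltW|apply: exprn_ege1; exact: ltW].
Qed.

(** Suppose that [M n <= c ^ n] from [N] on.  Passing from [n] to [3 n] then
    triples the main exponent of a bound [a n <= c ^ (n + E)], but only doubles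
    its error term [E].  Along [3 ^ k N] the error becomes negligible, against
    the lower bound [c ^ (2 n)]. *)
Lemma middle_lower_bound (R : realType) (a M : nat -> nat) (c : R) :
  1 < c ->
  (forall n, (a (3 * n) <= a n * M n * a n)%N) ->
  (forall n, (0 < n)%N -> c ^+ (2 * n) <= (a n)%:R) ->
  forall n0, exists2 n, (n0 <= n)%N & c ^+ n <= (M n)%:R.
Proof.
move=> c1 aM low n0; apply: contrapT => small.
have c0 : 0 < c by apply: lt_trans c1.
pose N := n0.+1.
have Msmall n : (N <= n)%N -> (M n)%:R <= c ^+ n.
  move=> Nn; rewrite leNgt; apply/negP => Mn; apply: small.
  exists n; last exact: ltW.
  exact: ltnW.
have [j /ltW aj] := expr_unbounded (a N)%:R c1.
have up k : (a (3 ^ k * N)%N)%:R <= c ^+ (3 ^ k * N + j * 2 ^ k).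
  elim: k => [|k IH].
    by rewrite !expn0 mul1n muln1 (le_trans aj) // ler_weXn2l ?ltW // leq_addl.
  set n := (3 ^ k * N)%N in IH *.
  have -> : (3 ^ k.+1 * N = 3 * n)%N by rewrite expnS /n mulnA.
  have Nn : (N <= n)%N by rewrite /n leq_pmull // expn_gt0.
  apply: le_trans (_ : (a n)%:R * (M n)%:R * (a n)%:R <= _).
    by rewrite -!natrM ler_nat.
  have -> : (3 * n + j * 2 ^ k.+1 =
     n + j * 2 ^ k + n + (n + j * 2 ^ k))%N by rewrite expnS; lia.
  rewrite (exprD _ _ (n + j * 2 ^ k)) (exprD _ _ n).
  by rewrite ler_pM ?mulr_ge0 // ler_pM // Msmall.
pose k := (2 * j)%N.
have := le_trans (low (3 ^ k * N)%N _) (up k).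
rewrite muln_gt0 expn_gt0 => /(_ isT).
rewrite ler_eXn2l //; have := pow3_gt j; rewrite -/k /N; nia.
Qed.

(** * Distances and geodesics in a connected graph *)

Section GraphDistance.
Context {V : choiceType} (e : rel V).

Lemma gdist_le_size x y p : is_path e x y p -> (gdist e x y <= size p)%N.
Proof.
move=> xyp; rewrite /gdist; case: pselect => // h.
by case: ex_minnP => m _; apply; apply/asboolP; exists p.
Qed.

Lemma gdistxx x : gdist e x x = 0%N.
Proof. by apply/eqP; rewrite -leqn0; apply: (@gdist_le_size x x [::]). Qed.

Lemma is_path_cat x y z p q :
  is_path e x y p -> is_path e y z q -> is_path e x z (p ++ q).
Proof. by move=> [ep <-] [eq <-]; split; rewrite ?cat_path ?ep ?last_cat. Qed.

Context (e_sym : symmetric e).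
Context (e_connected : forall x y, exists p, is_path e x y p).

Lemma geodesic_exists x y : exists2 p, is_path e x y p & size p = gdist e x y.
Proof.
have [p xyp] := e_connected x y; rewrite /gdist; case: pselect => [h|[]].
  by case: ex_minnP => m /asboolP[q [? ?]] _; exists q.
by exists (size p); apply/asboolP; exists p.
Qed.

Lemma gdist_eq0 x y : gdist e x y = 0%N -> x = y.
Proof. by have [p [_ <-] <-] := geodesic_exists x y; move=> /size0nil ->. Qed.

Lemma gdist_triangle y x z : (gdist e x z <= gdist e x y + gdist e y z)%N.
Proof.
have [p xyp <-] := geodesic_exists x y; have [q yzq <-] := geodesic_exists y z.
by rewrite -size_cat; apply: gdist_le_size; apply: is_path_cat xyp yzq.
Qed.

Lemma gdist_sym x y : gdist e x y = gdist e y x.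
Proof.
wlog suff : x y / (gdist e y x <= gdist e x y)%N.
  by move=> H; apply/eqP; rewrite eqn_leq !H.
have [p [ep lp] <-] := geodesic_exists x y.
rewrite -(size_belast x) -size_rev; apply: gdist_le_size; split.
  by rewrite -lp rev_path (eq_path (e' := e)) // => u v; rewrite e_sym.
by case: p lp {ep} => [<-|z p _] //=; rewrite rev_cons last_rcons.
Qed.

Lemma gdist_through_path x y p v : is_path e x y p -> v \in x :: p ->
  (gdist e x v + gdist e v y <= size p)%N.
Proof.
move=> [ep lp] vp; case/splitPl: vp ep lp => p1 p2 lv.
rewrite cat_path last_cat lv size_cat => /andP[ep1 ep2] lp.
by apply: leq_add; apply: gdist_le_size.
Qed.

Lemma geodesic_point x y m k : gdist e x y = (m + k)%N ->
  exists2 v, gdist e x v = m & gdist e v y = k.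
Proof.
move=> dxy; have [p [ep lp]] := geodesic_exists x y; rewrite dxy => sp.
have := ep; rewrite -(cat_take_drop m p) cat_path => /andP[ep1 ep2].
pose v := last x (take m p).
have dm : (gdist e x v <= m)%N.
  apply: leq_trans (gdist_le_size (conj ep1 erefl)) _.
  by rewrite size_take_min geq_minl.
have dk : (gdist e v y <= k)%N.
  have -> : k = size (drop m p) by rewrite size_drop sp addKn.
  by apply: gdist_le_size; split=> //; rewrite -last_cat cat_take_drop.
by exists v; have := gdist_triangle v x y; rewrite dxy; lia.
Qed.

(** * Bigons from detours *)

Lemma set_nbhdPn (R : realType) (C : R) (Y : set V) v u :
  ~ set_nbhd e C Y v -> Y u -> C < (gdist e v u)%:R.
Proof.
move=> vY Yu; rewrite ltNge; apply/negP => uC; apply: vY.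
apply: le_trans (_ : (gdist e v u)%:R%:E <= _)%E; last by rewrite lee_fin.
by apply: ereal_inf_lbound; exists v, u.
Qed.

(** An infimum of distances that all exceed [s] might equal [s]; the margin [1]
    keeps it strictly above. *)
Lemma dist_sets_gt (R : realType) (s : R) (A B : set V) :
  (forall u v, A u -> B v -> s + 1 <= (gdist e u v)%:R) ->
  (s%:E < dist_sets e A B)%E.
Proof.
move=> AB; apply: (@lt_le_trans _ _ (s + 1)%:E); first by rewrite lte_fin; lra.
by apply: le_ereal_inf_tmp => _ [u [v [Au Bv ->]]]; rewrite lee_fin AB.
Qed.

(** Divergence is an infimum of lengths; the extra unit of length makes the bound
    strict, so that some actual path satisfies it. *)
Lemma detour_exists (R : realType) (C : R) (m : nat) a b c :
  (Div_graph e m <= (C * m%:R)%:E)%E -> (gdist e a b <= m)%N ->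
  c <> a -> c <> b ->
  exists p, [/\ is_path e a b p, (size p)%:R <= C * m%:R + 1 &
    {in a :: p, forall v,
      (minn (gdist e c a) (gdist e c b))%:R / 2 - 2 < (gdist e c v)%:R :> R}].
Proof.
move=> divC abm /eqP ca /eqP cb.
have : (divergence e a b c < (C * m%:R + 1)%:E)%E.
  apply: (@le_lt_trans _ _ (C * m%:R)%:E); last by rewrite lte_fin ltrDl.
  apply: le_trans divC; apply: (@le_trans _ _ (Div e a b)).
    by apply: ereal_sup_ubound; exists c.
  by apply: ereal_sup_ubound; exists a, b.
move=> /ereal_inf_lt[_ [p [abp avoid ->]]]; rewrite lte_fin => /ltW sp.
by exists p; split=> // v /avoid; rewrite /gball /= => /negP; rewrite -ltNge.
Qed.

(** With [c] the midpoint of [x0] and [x], the detour stays at distance at least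
    about [3 n / 4] from [c], while the geodesic from [x0] to [x] stays within
    [n / 2] of it, so [n / 4 > s] up to rounding keeps them apart.  The other
    parts of the second path leave [x0] and [x] in directions opposite to
    that geodesic. *)
Lemma bigon_in_long_geodesic (R : realType) (C s : R) (n : nat) a x0 x b :
  0 <= C -> 0 <= s ->
  (Div_graph e (3 * n) <= (C * (3 * n)%:R)%:E)%E ->
  4 * s + 20 <= n%:R ->
  gdist e a x0 = n -> gdist e x0 x = n -> gdist e x b = n ->
  gdist e a b = (3 * n)%N ->
  bigon_vertices e x0 (3 + 3 * C) s (s + 1) x.
Proof.
move=> C0 s0 divn sn ax0 x0x xb ab.
have n0 : (20 <= n)%N by rewrite -(ler_nat R); lra.
have tri := gdist_triangle; have sy := gdist_sym.
have [c x0c cx] : exists2 c, gdist e x0 c = n./2 & gdist e c x = uphalf n.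
  by apply: geodesic_point; rewrite x0x; lia.
have ac : gdist e c a = (n + n./2)%N.
  have := tri x0 a c; have := tri c a b; have := tri x c b.
  rewrite (sy c a); lia.
have bc : gdist e c b = (n + uphalf n)%N.
  have := tri x c b; have := tri c a b; rewrite (sy a c); lia.
have [p [abp sp avoid]] : exists p, [/\ is_path e a b p,
    (size p)%:R <= C * (3 * n)%:R + 1 & {in a :: p, forall v,
      (minn (gdist e c a) (gdist e c b))%:R / 2 - 2 < (gdist e c v)%:R :> R}].
  apply: detour_exists; rewrite ?ab //.
    by move=> Eca; move: ac; rewrite Eca gdistxx; lia.
  by move=> Ecb; move: bc; rewrite Ecb gdistxx; lia.
(* [1 / 4] accounts for the parity of [n]. *)
have {}avoid v : v \in a :: p ->
    3 * n%:R / 4 - 2 - 1/4 <= (gdist e c v)%:R :> R.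
  move=> /avoid; rewrite ac bc (minn_idPl _) ?natrD; last by lia.
  have : (n <= 2 * n./2 + 1)%N by lia.
  by rewrite -(ler_nat R) natrD natrM; lra.
(* The first path has to pass through [c] itself: another geodesic from [x0] to
   [x] might leave the ball of radius [n / 2] around [c]. *)
have [p1 x0cp1 sp1] := geodesic_exists x0 c.
have [p2 cxp2 sp2] := geodesic_exists c x.
have x0xp := is_path_cat x0cp1 cxp2.
have sp12 : size (p1 ++ p2) = n by rewrite size_cat sp1 sp2 x0c cx; lia.
have [q x0aq sq] := geodesic_exists x0 a.
have [r bxr sr] := geodesic_exists b x.
rewrite sy ax0 in sq; rewrite sy xb in sr.
exists (p1 ++ p2), (q ++ (p ++ r)); split => //.
- by apply: is_path_cat x0aq _; apply: is_path_cat abp _.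
- by rewrite sp12 x0x; nra.
- rewrite !size_cat sq sr x0x !natrD; move: sp; rewrite natrM.
  have : 20 <= n%:R :> R by lra.
  nra.
- apply: dist_sets_gt => u v [/= up uB] [/= vp vB].
  have u0 := gdist_through_path x0xp up; rewrite sp12 in u0.
  have cu : (gdist e c u <= uphalf n)%N.
    move: up; rewrite in_cons mem_cat orbA -in_cons => /orP[up|up].
      have := gdist_through_path x0cp1 up; rewrite sp1 x0c (sy c); lia.
    have := gdist_through_path cxp2 (mem_behead (s := c :: p2) up).
    rewrite sp2 cx; lia.
  have vx0 := set_nbhdPn vB (or_introl erefl).
  have vx := set_nbhdPn vB (or_intror erefl).
  have [vq|[vpp|vr]] : v \in x0 :: q \/ (v \in a :: p \/ v \in b :: r).
    move: vp; rewrite in_cons !mem_cat !in_cons.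
    by case/or4P => ->; rewrite ?orbT; auto.
  (* [v] on the way back to [a]: [d(a, x) = 2 n] makes [d(u, v) >= d(x0, v)]. *)
  + have := gdist_through_path x0aq vq; rewrite sq => v0.
    apply: ltW; apply: lt_le_trans vx0 _; rewrite ler_nat.
    have := tri v a x; have := tri u v x; have := tri x a b.
    rewrite (sy a v) (sy x0 v) (sy v u) in v0 *; lia.
  (* [v] on the detour, outside the ball around [c] that contains [u] *)
  + have := avoid _ vpp.
    have := tri u c v; rewrite -(ler_nat R) natrD => h1 h2.
    have : (2 * uphalf n <= n + 1)%N by lia.
    move: cu; rewrite -!(ler_nat R) natrD natrM; lra.
  (* [v] on the return from [b]: [d(x0, b) = 2 n] makes [d(u, v) >= d(x, v)]. *)
  + have := gdist_through_path bxr vr; rewrite sr => v0.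
    apply: ltW; apply: lt_le_trans vx _; rewrite ler_nat.
    have := tri v x0 b; have := tri u x0 v; have := tri x0 a b.
    rewrite (sy b v) in v0; lia.
Qed.

End GraphDistance.

(** * Counting *)

Lemma infinite_set_unbounded (A : set nat) :
  (forall n0, exists2 n, (n0 <= n)%N & A n) -> infinite_set A.
Proof.
move=> unb /finite_fsetP[X AX].
have [n ltn An] := unb (\max_(i <- X) i).+1.
have : n \in X by move: An; rewrite AX.
move=> nX; have := @leq_bigmax_seq nat (enum_fset X) xpredT id _ nX isT.
by rewrite leqNgt ltn.
Qed.

Lemma card_fset_set_sub (T : choiceType) (A B : set T) :
  finite_set B -> A `<=` B -> (#|` fset_set A| <= #|` fset_set B|)%N.
Proof.
move=> finB AB; apply: fsubset_leq_card.
by rewrite -fset_set_sub //; apply: sub_finite_set finB.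
Qed.

Lemma card_fset_set_image2 (T T' U : choiceType) (f : T -> T' -> U)
    (A : set T) (B : set T') (D : set U) :
  finite_set A -> finite_set B -> D `<=` [set f x y | x in A & y in B] ->
  (#|` fset_set D| <= #|` fset_set A| * #|` fset_set B|)%N.
Proof.
move=> finA finB sD; have finD : finite_set D.
  by apply: sub_finite_set sD _; apply: finite_image2.
rewrite -(size_allpairs f); apply: (uniq_leq_size (fset_uniq _)) => z.
rewrite in_fset_set // inE => /sD[x Ax [y By <-]].
by apply: allpairs_f; rewrite in_fset_set // inE.
Qed.

(** * Spheres and middle thirds in a Cayley graph *)

Section CayleyGraph.
Context {G : groupType} (S : {fset G}) (S_gen : symmetric_generating_set S).
Local Notation e := (cayley S).
Local Notation d := (gdist e).

Lemma cayley_sym : symmetric e.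
Proof.
have sub x y : e x y -> e y x.
  by move=> /S_gen.1; rewrite invgM invgK.
by move=> x y; apply/idP/idP; apply: sub.
Qed.

Lemma cayley_connected x y : exists p, is_path e x y p.
Proof.
have [w wS] := S_gen.2 (x^-1 * y)%g; move=> /(canRL (mulVKg x)) ->.
elim: w x wS => [|s w IH] x wS.
  by exists [::]; split; rewrite //= big_nil mulg1.
have [|p [ep lp]] := IH (x * s)%g.
  by move=> z zw; apply: wS; rewrite in_cons zw orbT.
exists ((x * s)%g :: p); split; last by rewrite /= lp big_cons mulgA.
by rewrite /= ep andbT /cayley mulKg wS ?mem_head.
Qed.

Let geodesic_exists := geodesic_exists cayley_connected.

Lemma gdist_mull g x y : d (g * x)%g (g * y)%g = d x y.
Proof.
have le h u v : (d (h * u)%g (h * v)%g <= d u v)%N.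
  have [p [ep <-] <-] := geodesic_exists u v.
  rewrite -(size_map (fun z => h * z)%g) -(last_map (fun z => h * z)%g).
  apply: gdist_le_size; split=> //; rewrite path_map.
  rewrite (eq_path (e' := e)) // => a b.
  by rewrite /relpre /cayley /= invgM mulgA mulgVK.
by apply/eqP; rewrite eqn_leq le /= -{1}(mulKg g x) -{1}(mulKg g y) le.
Qed.

Lemma gdist_mulr x y : d x (x * y)%g = d 1%g y.
Proof. by rewrite -{1}(mulg1 x) gdist_mull. Qed.

Definition sphere n : set G := [set g | d 1%g g = n].

Lemma sphere_add m n :
  sphere (m + n) `<=` [set (x * y)%g | x in sphere m & y in sphere n].
Proof.
move=> g /(geodesic_point cayley_connected)[x dx dxg].
exists x => //; exists (x^-1 * g)%g; last by rewrite mulVKg.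
by rewrite /sphere /= -(gdist_mulr x) mulVKg.
Qed.

Lemma finite_sphere n : finite_set (sphere n).
Proof.
elim: n => [|n IH].
  apply: (@sub_finite_set _ _ [set 1%g]); last exact: finite_set1.
  by move=> g /(gdist_eq0 cayley_connected).
have fin1 : finite_set (sphere 1).
  apply: (@sub_finite_set _ _ [set` S]); last exact: finite_fset.
  move=> g g1 /=; have [p [ep lp]] := geodesic_exists 1%g g.
  rewrite g1; case: p ep lp => [|z [|]] //=.
  by rewrite andbT /cayley invg1 mul1g => + <-.
rewrite -addn1; apply: sub_finite_set (@sphere_add n 1) _.
exact: finite_image2.
Qed.

Lemma finite_gball (R : realType) x n : finite_set (gball e x (n%:R : R)).
Proof.
apply: (@sub_finite_set _ _
  (\bigcup_(i in `I_n.+1) [set (x * g)%g | g in sphere i])).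
  move=> y; rewrite /gball /= ler_nat => xy; exists (d x y) => //.
  by exists (x^-1 * y)%g; rewrite ?mulVKg // /sphere /= -(gdist_mulr x) mulVKg.
by apply: bigcup_finite => // i _; apply/finite_image/finite_sphere.
Qed.

Local Notation sphere_card n := #|` fset_set (sphere n)|.

Lemma gball_card (R : realType) n :
  (#|` fset_set (gball e 1%g (n%:R : R))| <= \sum_(i < n.+1) sphere_card i)%N.
Proof.
rewrite trivIset_sum_card.
- apply: card_fset_set_sub.
    rewrite -bigcup_mkord; apply: bigcup_finite => // i _.
    exact: finite_sphere.
  by rewrite -bigcup_mkord => y; rewrite /gball /= ler_nat; exists (d 1%g y).
- exact: finite_sphere.
- by move=> i j _ _ [g [<- <-]].
Qed.

Definition middle n : set G := [set x | sphere n x /\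
  exists a b, [/\ sphere n a, sphere n b & sphere (3 * n) (a * x * b)%g]].

Lemma finite_middle n : finite_set (middle n).
Proof. by apply: sub_finite_set (finite_sphere n) => x []. Qed.

Lemma sphere_card_middle n :
  (sphere_card (3 * n) <=
     sphere_card n * #|` fset_set (middle n)| * sphere_card n)%N.
Proof.
pose Y := [set (a * x)%g | a in sphere n & x in middle n].
have finS := finite_sphere n; have finM := finite_middle n.
have finY : finite_set Y by apply: finite_image2.
apply: leq_trans (_ : #|` fset_set Y| * sphere_card n <= _)%N; last first.
  by rewrite leq_mul2r (@card_fset_set_image2 _ _ _ (fun a x => a * x)%g) ?orbT.
apply: (@card_fset_set_image2 _ _ _ (fun y b => y * b)%g) => // g g3.
have : sphere (n + n + n) g by have -> : (n + n + n = 3 * n)%N by lia.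
move=> /sphere_add[y /sphere_add[a an [x xn <-]] [b bn gE]].
exists (a * x)%g; last by exists b.
by exists a => //; exists x => //; split=> //; exists a, b; rewrite gE.
Qed.

(** Translating the geodesic word [a x b] so that [x] starts at [x0] gives the
    geodesic with division points [x0 a^-1], [x0], [x0 x], [x0 x b]. *)
Lemma middle_bigon (R : realType) (C s : R) n x0 x :
  0 <= C -> 0 <= s -> (Div_graph e (3 * n) <= (C * (3 * n)%:R)%:E)%E ->
  4 * s + 20 <= n%:R -> middle n x ->
  bigon_vertices e x0 (3 + 3 * C) s (s + 1) (x0 * x)%g.
Proof.
move=> C0 s0 divn sn [xn [a [b [an bn axb]]]].
apply: (bigon_in_long_geodesic cayley_sym cayley_connected
  (a := (x0 * a^-1)%g) (b := (x0 * x * b)%g) C0 s0 divn sn).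
- by rewrite -{2}(mulgVK a x0) gdist_mulr.
- by rewrite gdist_mulr.
- by rewrite gdist_mulr.
- rewrite -axb -[RHS](gdist_mull (x0 * a^-1)%g) mulg1 !mulgA; congr d.
  by rewrite mulgVK.
Qed.

End CayleyGraph.

(** * Exponentially many fat bigons *)

Theorem proposition1p2 (R : realType) (G : groupType) (S : {fset G})
    (S_gen : symmetric_generating_set S)
    (G_growth : exponential_growth (cayley S) R 1%g)
    (G_div : linear_divergence (cayley S) R) (x0 : G) :
  exponentially_many_fat_bigons (cayley S) R x0.
Proof.
have [c0 c01 growth] := G_growth; have [C0 div0] := G_div.
pose C := Num.max C0 0.
have C_ge0 : 0 <= C by rewrite le_max lexx orbT.
have divC n : (1 <= n)%N -> (Div_graph (cayley S) n <= (C * n%:R)%:E)%E.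
  move=> n1; apply: le_trans (div0 n n1) _.
  by rewrite lee_fin ler_wpM2r // le_max lexx.
pose a n := #|` fset_set (sphere S n)|.
pose M n := #|` fset_set (middle S n)|.
have aM m n : (a (m + n) <= a m * a n)%N.
  apply: (card_fset_set_image2 (finite_sphere S_gen m) (finite_sphere S_gen n)).
  exact: sphere_add.
have [|t t1 low] := submultiplicative_lower_bound c01 aM.
  by move=> n; apply: le_trans (growth n) _; rewrite ler_nat gball_card.
(* Any rate strictly between [1] and [t] would do; for [c = sqrt t] the lower
   bound on spheres reads [c ^ (2 n)]. *)
pose c := Num.sqrt t.
have c1 : 1 < c by rewrite -sqrtr1 ltr_sqrt // (lt_trans _ t1).
have mid : forall n0, exists2 n, (n0 <= n)%N & c ^+ n <= (M n)%:R.
  apply: (middle_lower_bound c1 (sphere_card_middle S_gen)) => n n0.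
  by rewrite exprM sqr_sqrtr ?low // ltW // (lt_trans _ t1).
exists 2, c, (3 + 3 * C); split=> //; [lra|lra|].
move=> s s2; exists (s + 1); first lra.
apply: infinite_set_unbounded => n0.
have [n nbig cM] := mid (maxn n0 (Num.bound (4 * s + 20)).+1).
move: nbig; rewrite geq_max => /andP[n0n bn].
exists n => //=; apply: le_trans cM _; rewrite ler_nat /M.
have sn : 4 * s + 20 <= n%:R.
  apply: ltW; apply: lt_le_trans (_ : (Num.bound (4 * s + 20))%:R <= _).
    by apply: archi_boundP; lra.
  by rewrite ler_nat ltnW.
(* Left translation by [x0] injects the middle thirds into the bigon vertices. *)
rewrite -(size_map (fun x => x0 * x)%g); apply: uniq_leq_size.
  by rewrite map_inj_uniq ?fset_uniq //; exact: mulgI.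
move=> _ /mapP[x + ->]; rewrite in_fset_set ?inE; last exact: finite_middle.
move=> xM; rewrite in_fset_set; last first.
  by apply: sub_finite_set (finite_gball S_gen R x0 n) => y [].
rewrite inE; split.
  by apply: middle_bigon xM => //; [lra|apply: divC; lia].
by rewrite /gball /= gdist_mulr // ler_nat xM.1.
Qed.
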